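(* If $\alpha$ is badly approximable, $\{r_i\}_{i=1}^{\infty}$ is non-increasing, and $\sum r_i=\infty$, then for any $a\in[0,1)$ $$\lim_{N\to\infty}\frac{\sum_{i=1}^N\chi_{B(a,r_i)}(R_\alpha^i x)}{\sum_{i=1}^N 2r_i}=1$$ for almost every $x$.
   Context: For $\alpha\in[0,1)$, $R_\alpha:[0,1)\to[0,1)$ is the rotation $R_\alpha(x)=x+\alpha \bmod 1$. Writing $[a_1,a_2,\dots]$ for the continued fraction expansion of the irrational number $\alpha$, $\alpha$ is badly approximable if $\limsup_{n\to\infty}a_n<\infty$. $\{r_i\}$ is a sequence of radii, $B(a,r)$ is the ball of radius $r$ about $a$, and $\chi_A$ is the indicator function of $A$. ''Almost every'' is with respect to Lebesgue measure on $[0,1)$.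
   Formalization: The formal theorem adds that the limit of the radii r_i is at most 1/2, balls being taken on the circle; without this the claim is false, since a limit c > 1/2 makes every ball the whole circle and the ratio tends to 1/(2c), not 1. *)

(* Defs.v *)
From mathcomp Require Import all_boot all_order all_algebra.
From mathcomp Require Import all_classical all_reals all_analysis.

Set Implicit Arguments.
Unset Strict Implicit.
Unset Printing Implicit Defensive.

Import Order.TTheory GRing.Theory Num.Theory.
Import numFieldNormedType.Exports.

Local Open Scope classical_set_scope.
Local Open Scope ring_scope.

Definition frac_part {R : realType} (x : R) : R := x - (Num.floor x)%:~R.

Definition rotation {R : realType} (alpha x : R) : R := frac_part (x + alpha).

Definition gauss_map {R : realType} (x : R) : R := frac_part x^-1.

(* [partial_quotient alpha n] is the continued fraction digit a_(n+1) of
   alpha = [a_1, a_2, ...]; it is meaningful for irrational alpha in [0, 1). *)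
Definition partial_quotient {R : realType} (alpha : R) (n : nat) : int :=
  Num.floor (iter n gauss_map alpha)^-1.

Definition badly_approximable {R : realType} (alpha : R) : Prop :=
  irrational alpha /\
  (limn_esup (fun n => ((partial_quotient alpha n)%:~R : R)%:E) < +oo)%E.

(* [0, 1) is the circle R/Z: for x, y in [0, 1) this is the distance from
   x - y to the nearest integer.  With the distance of the line instead, balls
   around points near 0 would be cut off, and B(0, r) would have measure r. *)
Definition circle_dist {R : realType} (x y : R) : R :=
  Num.min `|x - y| (1 - `|x - y|).

Definition circle_ball {R : realType} (a r : R) : set R :=
  [set y | 0 <= y < 1 /\ circle_dist a y < r].

(* Main.v *)
Require Import Defs.
From HB Require Import structures.
From mathcomp Require Import all_boot all_order all_algebra.
From mathcomp Require Import all_classical all_reals all_analysis.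
From mathcomp Require Import measurable_realfun ring lra zify.

Set Implicit Arguments.
Unset Strict Implicit.
Unset Printing Implicit Defensive.

Import Order.TTheory GRing.Theory Num.Theory.
Import numFieldNormedType.Exports.

Local Open Scope classical_set_scope.
Local Open Scope ring_scope.

(** The proof is a second moment argument.  Write [b_i x] for the indicator of
    [R_alpha^i x] lying in the [i]-th ball, [m_i = min (2 r_i) 1] for its mean,
    [S_N] for the sum of the [b_i], [i < N], and [E_N] for the sum of the [m_i].
    Everything follows from a variance bound
      [mean ((S_N - E_N) ^ 2) <= 2 (E_N / s + K s) E_N], for every [s >= 1],
    with [K] depending on [alpha] only ([variance_le]).

    To bound the covariances of one [b_i] with all later [b_j], move the origin
    to the target: by invariance of the mean under rotation, the pair [(i, j)]
    contributes the mean over [y] of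
      [chi_j y * (chi_i (y - (j - i) alpha) - m_i)],
    where [chi_j] is the indicator of the [j]-th ball.  The balls are nested, so
    for fixed [y] the indices [j] with [chi_j y = 1] form an initial segment, and
    the sum over [j] compares the number of visits of a segment of one orbit to
    one fixed arc with its expected value.  So the radii have disappeared from
    the problem, and only a discrepancy estimate for arcs is left.

    That estimate ([orbit_count_le]) says that an orbit segment of length [n]
    visits an arc of measure [m] at most [n m + n m / s + K s] times.  It is
    here that [alpha] has to be badly approximable: the denominators of its
    convergents grow at most geometrically, so there is one, [q], of size
    comparable to [s / m].  An orbit segment of length [q] lies within [1 / q] of
    a coset of the cyclic group of order [q] in the circle, so it visits the arc
    at most [q m + 4] times ([block_count]); cut the orbit into such segments.

    With [s = (k + 1) ^ 2] and along times where [E_N] is about [(k + 1) ^ 4], the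
    variance of [S_N / E_N] is summable, hence [S_N / E_N] tends to [1] almost
    everywhere along these times, and by monotonicity of [S_N] and [E_N] along
    all times ([ae_hits_ratio]).  Finally [E_N] and the sum of the [2 r_i] are
    asymptotically equal because the limit of the radii is at most [1 / 2]. *)

(** * The mean over the circle *)

Section Mean.
Variable R : realType.
Implicit Types (f g : R -> R).

(** Functions on the circle are represented by functions on the whole line; only
    bounded ones occur, so this class makes all integrability conditions
    automatic and is stable under the operations needed. *)
Definition bounded_measurable f :=
  measurable_fun [set: R] f /\ exists M, forall x, `|f x| <= M.

Definition mean f : R := \int[lebesgue_measure]_(x in `[0, 1[) f x.

Lemma unit_interval_measure : lebesgue_measure (`[0, 1[%classic : set R) = 1%:E.
Proof. by rewrite lebesgue_measure_itv /= lte_fin ltr01 -EFinB subr0. Qed.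

Lemma bounded_measurable_integrable f (D : set R) :
  measurable D -> (lebesgue_measure D < +oo)%E ->
  bounded_measurable f -> lebesgue_measure.-integrable D (EFin \o f).
Proof.
move=> mD fD [mf [M bM]]; apply: measurable_bounded_integrable => //.
  exact: measurable_funS mf.
exists M; split; first exact: num_real.
by move=> x Mx y _; exact: le_trans (bM y) (ltW Mx).
Qed.

Lemma bounded_measurable_integrable1 f : bounded_measurable f ->
  lebesgue_measure.-integrable `[0, 1[ (EFin \o f).
Proof.
by apply: bounded_measurable_integrable => //; rewrite unit_interval_measure ltry.
Qed.

Lemma bounded_measurable_cst c : bounded_measurable (fun=> c).
Proof. by split; [exact: measurable_cst|exists `|c|]. Qed.

Lemma bounded_measurableD f g : bounded_measurable f -> bounded_measurable g ->
  bounded_measurable (fun x => f x + g x).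
Proof.
move=> [mf [M bM]] [mg [M' bM']]; split; first exact: measurable_funD.
by exists (M + M') => x; apply: le_trans (ler_normD _ _) _; rewrite lerD.
Qed.

Lemma bounded_measurableM f g : bounded_measurable f -> bounded_measurable g ->
  bounded_measurable (fun x => f x * g x).
Proof.
move=> [mf [M bM]] [mg [M' bM']]; split; first exact: measurable_funM.
by exists (M * M') => x; rewrite normrM ler_pM.
Qed.

Lemma bounded_measurableB f g : bounded_measurable f -> bounded_measurable g ->
  bounded_measurable (fun x => f x - g x).
Proof.
move=> bf bg; under eq_fun do rewrite -mulN1r.
apply: bounded_measurableD => //; apply: bounded_measurableM => //.
exact: bounded_measurable_cst.
Qed.

Lemma bounded_measurable_sum (I : Type) (s : seq I) (P : pred I) (F : I -> R -> R) :
  (forall i, bounded_measurable (F i)) ->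
  bounded_measurable (fun x => \sum_(i <- s | P i) F i x).
Proof.
move=> bF; elim: s => [|i s IH].
  under eq_fun do rewrite big_nil; exact: bounded_measurable_cst.
under eq_fun do rewrite big_cons; case: (P i) => //.
exact: bounded_measurableD.
Qed.

Lemma bounded_measurable_shift f t : bounded_measurable f ->
  bounded_measurable (fun x => f (x + t)).
Proof.
move=> [mf [M bM]]; split; last by exists M.
by apply: (measurableT_comp mf); exact: measurable_funD.
Qed.

Lemma bounded_measurable_indic (A : set R) : measurable A ->
  bounded_measurable (\1_A).
Proof.
move=> mA; split; first exact: measurable_indic.
by exists 1 => x; rewrite indicE; case: (_ \in _); rewrite ?normr1 ?normr0.
Qed.

Lemma mean_cst c : mean (fun=> c) = c.
Proof. by rewrite /mean Rintegral_cst //= unit_interval_measure mulr1. Qed.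

Lemma meanD f g : bounded_measurable f -> bounded_measurable g ->
  mean (fun x => f x + g x) = mean f + mean g.
Proof.
move=> bf bg; rewrite /mean RintegralD //; exact: bounded_measurable_integrable1.
Qed.

Lemma meanZ c f : bounded_measurable f -> mean (fun x => c * f x) = c * mean f.
Proof.
move=> bf; rewrite /mean RintegralZl //; exact: bounded_measurable_integrable1.
Qed.

Lemma meanB f g : bounded_measurable f -> bounded_measurable g ->
  mean (fun x => f x - g x) = mean f - mean g.
Proof.
move=> bf bg; rewrite /mean RintegralB //; exact: bounded_measurable_integrable1.
Qed.

Lemma mean_sum (I : Type) (s : seq I) (P : pred I) (F : I -> R -> R) :
  (forall i, bounded_measurable (F i)) ->
  mean (fun x => \sum_(i <- s | P i) F i x) = \sum_(i <- s | P i) mean (F i).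
Proof.
move=> bF; elim: s => [|i s IH].
  by under eq_fun do rewrite big_nil; rewrite mean_cst big_nil.
under eq_fun do rewrite big_cons; rewrite big_cons; case: (P i) => //.
by rewrite meanD ?IH //; exact: bounded_measurable_sum.
Qed.

Lemma le_mean f g : bounded_measurable f -> bounded_measurable g ->
  (forall x, f x <= g x) -> mean f <= mean g.
Proof.
by move=> bf bg fg; apply: le_Rintegral => //; exact: bounded_measurable_integrable1.
Qed.

(** Lebesgue measure is its own image under a translation, because the two
    measures agree on the intervals [`]u, v]], and that is enough. *)
Lemma Rintegral_translation t f (D : set R) : measurable D ->
  (lebesgue_measure D < +oo)%E -> bounded_measurable f ->
  \int[lebesgue_measure]_(x in D) f x =
  \int[lebesgue_measure]_(x in (fun x => x + t) @^-1` D) f (x + t).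
Proof.
move=> mD fD bf.
have mt : measurable_fun [set: measurableTypeR R]
    ((fun x => x + t) : measurableTypeR R -> measurableTypeR R).
  exact: measurable_funD.
pose mt' := isMeasurableFun.Build _ _ _ _ _ mt.
pose phi : {mfun measurableTypeR R >-> measurableTypeR R} :=
  HB.pack ((fun x => x + t) : measurableTypeR R -> measurableTypeR R) mt'.
have invariant (A : set R) : measurable A ->
    lebesgue_measure A = pushforward lebesgue_measure phi A.
  move=> mA.
  apply: (@lebesgue_measure_unique R (pushforward lebesgue_measure phi)) => // X.
  move=> /ocitvP[->|[[u v] /= uv ->]]; first by rewrite !measure0.
  rewrite /pushforward lebesgue_measure_itv /=.
  have -> : phi @^-1` `]u, v] = `]u - t, v - t]%classic.
    by apply/seteqP; split => x; rewrite /= !in_itv /= ltrBlDr lerBrDr.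
  rewrite lebesgue_measure_itv /= !lte_fin ltrD2r; case: ifP => // _.
  by rewrite -!EFinB; congr EFin; ring.
rewrite /Rintegral (eq_measure_integral (pushforward lebesgue_measure phi));
  last by move=> A mA _; exact: invariant.
congr fine; rewrite integral_pushforward //.
- apply: measurable_funS (measurableT) (@subsetT _ _) _.
  exact: measurableT_comp (@EFin_measurable _ _) bf.1.
- have := bounded_measurable_integrable (D := phi @^-1` D) _ _
    (bounded_measurable_shift t bf).
  apply; last by rewrite -[X in (X < _)%E]invariant.
  by rewrite -[_ @^-1` _]setTI; exact: (mt measurableT D mD).
Qed.

Definition periodic f := forall x (m : int), f (x + m%:~R) = f x.

(** Invariance of the mean under rotation: an interval of length one is cut at an
    integer and its two pieces are put back together in the other order. *)
Lemma mean_shift t f : bounded_measurable f -> periodic f ->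
  mean (fun x => f (x + t)) = mean f.
Proof.
move=> bf pf.
wlog t01 : t / 0 <= t < 1.
  move=> /(_ (t - (Num.floor t)%:~R)) <-; last first.
    have := floor_itv t; rewrite intrD subr_ge0 ltrBlDl; lra.
  congr mean; apply/funext => x.
  by rewrite -[in LHS](pf (x + t) (- Num.floor t)) mulrNz addrA.
have fin (u v : R) : (lebesgue_measure (`[u, v[%classic : set R) < +oo)%E.
  by rewrite lebesgue_measure_itv; case: ifP => _; rewrite ?ltry // -EFinB ltry.
have int g (u v : R) : bounded_measurable g ->
    lebesgue_measure.-integrable `[u, v[ (EFin \o g).
  by move=> bg; apply: bounded_measurable_integrable.
have pre (u v s : R) : (fun x => x + s) @^-1` `[u, v[ = `[u - s, v - s[%classic.
  by apply/seteqP; split => x; rewrite /= !in_itv /= ltrBrDr lerBlDr.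
have split (u v w : R) : u <= v <= w ->
    \int[lebesgue_measure]_(x in `[u, w[) f x =
    \int[lebesgue_measure]_(x in `[u, v[) f x +
    \int[lebesgue_measure]_(x in `[v, w[) f x.
  move=> /andP[uv vw]; have -> : `[u, w[%classic = `[u, v[ `|` `[v, w[.
    by apply: itv_bndbnd_setU; rewrite bnd_simp.
  rewrite Rintegral_setU //.
    by rewrite -itv_bndbnd_setU ?bnd_simp //; exact: int.
  apply/disj_setPS => x [] /=; rewrite !in_itv /=; lra.
have meanE : mean (fun x => f (x + t)) =
    \int[lebesgue_measure]_(x in `[t, 1 + t[) f x.
  by rewrite (Rintegral_translation t) // pre subrr addrK.
rewrite meanE (split t 1 (1 + t)); last lra.
rewrite /mean (split 0 t 1); last lra.
rewrite addrC; congr (_ + _).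
rewrite (Rintegral_translation 1) // pre subrr addrAC subrr add0r.
by apply: eq_Rintegral => x _; exact: (pf x 1).
Qed.
End Mean.

(** * Arcs of the circle *)

Section Arc.
Variable R : realType.
Implicit Types (a r x y z : R) (m : int).

(** The lift to the line of the ball of centre [a] and radius [r] of the circle.
    On the circle itself the rotations would carry fractional parts along. *)
Definition arc a r : set R := [set y | exists m : int, `|y - a - m%:~R| < r].

Definition chi a r : R -> R := \1_(arc a r).

Definition arc_measure r : R := Num.min (2 * r) 1.

Lemma chi_arc a r y : arc a r y -> chi a r y = 1.
Proof. by move=> h; rewrite /chi indicE mem_set. Qed.

Lemma chi_not_arc a r y : ~ arc a r y -> chi a r y = 0.
Proof. by move=> h; rewrite /chi indicE memNset. Qed.

Lemma chi_ge0 a r y : 0 <= chi a r y.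
Proof. by rewrite /chi indicE; case: (_ \in _). Qed.

Lemma chi_le1 a r y : chi a r y <= 1.
Proof. by rewrite /chi indicE; case: (_ \in _). Qed.

Lemma chi_radius0 a r y : r <= 0 -> chi a r y = 0.
Proof.
move=> r0; apply: chi_not_arc => -[m].
by have := normr_ge0 (y - a - m%:~R); lra.
Qed.

Lemma le_chi a r d y y' : `|y' - y| <= d -> chi a r y <= chi a (r + d) y'.
Proof.
move=> yd; have [[m ym]|/chi_not_arc ->] := pselect (arc a r y).
  2: exact: chi_ge0.
rewrite [leRHS]chi_arc ?chi_le1 //; exists m.
have -> : y' - a - m%:~R = (y - a - m%:~R) + (y' - y) by ring.
by apply: le_lt_trans (ler_normD _ _) _; rewrite ltr_leD.
Qed.

Lemma arc_subset a r r' : r <= r' -> arc a r `<=` arc a r'.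
Proof. by move=> rr y [m ym]; exists m; exact: lt_le_trans rr. Qed.

Lemma chi_periodic a r : periodic (chi a r).
Proof.
move=> y k; rewrite /chi !indicE; congr (_%:R); congr nat_of_bool.
apply/idP/idP => /set_mem[m ym]; apply/mem_set.
  exists (m - k); rewrite intrB.
  by have -> : y - a - (m%:~R - k%:~R) = y + k%:~R - a - m%:~R by ring.
exists (m + k); rewrite intrD.
by have -> : y + k%:~R - a - (m%:~R + k%:~R) = y - a - m%:~R by ring.
Qed.

Lemma chi_center a r y t : chi (a - t) r y = chi a r (y + t).
Proof.
rewrite /chi !indicE; congr (_%:R); congr nat_of_bool.
have dist m : y - (a - t) - m%:~R = y + t - a - m%:~R by ring.
apply/idP/idP => /set_mem[m ym]; apply/mem_set; exists m; first by rewrite -dist.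
by rewrite dist.
Qed.

Lemma measurable_arc a r : measurable (arc a r).
Proof.
rewrite (_ : arc a r = \bigcup_(m in [set: int]) ball (a + m%:~R) r).
  by apply: open_measurable; apply: bigcup_open => m _; exact: ball_open.
apply/seteqP; split => y.
  by move=> [m ym]; exists m => //; rewrite /ball /= distrC opprD addrA.
by move=> [m _]; rewrite /ball /= distrC opprD addrA => ym; exists m.
Qed.

Lemma bounded_measurable_chi a r : bounded_measurable (chi a r).
Proof. by apply: bounded_measurable_indic; exact: measurable_arc. Qed.

Lemma arcT a r : 2^-1 < r -> arc a r = setT.
Proof.
move=> r2; apply/seteqP; split => // y _.
exists (Num.floor (y - a + 2^-1)); have := floor_itv (y - a + 2^-1).
rewrite intrD /= => h; apply: le_lt_trans r2; rewrite ler_norml; lra.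
Qed.

Lemma norm_sub_int (u : R) m : m != 0 -> 1 - `|u| <= `|u - m%:~R|.
Proof.
move=> m0; rewrite lerBlDr.
have m1 : 1 <= `|m%:~R : R| by rewrite -intr_norm ler1z -gtz0_ge1 normr_gt0.
apply: (le_trans m1); rewrite -(normrN m%:~R).
have -> : `|- m%:~R : R| = `|(u - m%:~R) - u| by congr `|_|; ring.
exact: ler_normB.
Qed.

Lemma mean_chi a r : 0 <= r -> mean (chi a r) = arc_measure r.
Proof.
move=> r0; rewrite /arc_measure; have [r2|r2] := leP r 2^-1; last first.
  rewrite (_ : chi a r = fun=> 1); first by rewrite mean_cst min_r //; lra.
  by apply/funext => y; apply: chi_arc; rewrite arcT.
rewrite min_l; last lra.
(* centred at 1/2, the arc meets the unit interval in a single interval *)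
have -> : mean (chi a r) = mean (chi 2^-1 r).
  rewrite -(mean_shift (2^-1 - a) (bounded_measurable_chi _ _)
    (@chi_periodic 2^-1 r)).
  by congr mean; apply/funext => y; rewrite -chi_center; congr (chi _ _ _); ring.
rewrite /mean /Rintegral integral_indic //; last exact: measurable_arc.
have -> : arc 2^-1 r `&` `[0, 1[ = `](2^-1 - r), (2^-1 + r)[%classic.
  apply/seteqP; split => y /=; rewrite !in_itv /=.
    move=> [[m ym] y01].
    have [m0|m0] := eqVneq m 0.
      move: ym; rewrite m0 subr0 ltr_norml; lra.
    have := norm_sub_int (y - 2^-1) m0.
    have : `|y - 2^-1| <= 2^-1 by rewrite ler_norml; lra.
    lra.
  move=> yr; split; last lra.
  by exists 0; rewrite subr0 ltr_norml; lra.
transitivity (fine (lebesgue_measure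
  (`](2^-1 - r), (2^-1 + r)[%classic : set R))) => //.
rewrite lebesgue_measure_itv /= lte_fin; case: ifPn => h /=; lra.
Qed.

Lemma frac_part_itv x : 0 <= frac_part x < 1.
Proof. by have := floor_itv x; rewrite /frac_part intrD; lra. Qed.

Lemma chi_frac_part a r x : chi a r (frac_part x) = chi a r x.
Proof. by rewrite /frac_part -mulrNz chi_periodic. Qed.

Lemma circle_ball_chi a r x : 0 <= a < 1 ->
  \1_(circle_ball a r) (frac_part x) = chi a r x.
Proof.
move=> a01; rewrite -chi_frac_part; have := frac_part_itv x.
move: (frac_part x) => {x}y y01.
rewrite /chi !indicE; congr (_%:R); congr nat_of_bool.
apply/idP/idP => /set_mem; [move=> [_ yr]|move=> [m ym]]; apply/mem_set.
  move: yr; rewrite /circle_dist minEle; case: ifP => _ yr.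
    by exists 0; rewrite subr0 distrC.
  have [ya|ya] := leP a y.
    by exists 1; rewrite ltr_norml; move: yr; rewrite ler0_norm; lra.
  by exists (-1); rewrite ltr_norml; move: yr; rewrite gtr0_norm; lra.
split => //; rewrite /circle_dist gt_min distrC.
have [m0|m0] := eqVneq m 0; first by move: ym; rewrite m0 subr0 => ->.
apply/orP; right; apply: le_lt_trans ym; exact: norm_sub_int.
Qed.

Lemma frac_partD x y : frac_part (frac_part x + y) = frac_part (x + y).
Proof.
rewrite /frac_part; set k := Num.floor x.
have -> : x - k%:~R + y = x + y + (- k)%:~R by rewrite mulrNz; ring.
by rewrite floorDrz ?intr_int // intrKfloor intrD mulrNz; ring.
Qed.

Lemma iter_rotation (alpha x : R) (i : nat) :
  iter i.+1 (rotation alpha) x = frac_part (x + i.+1%:R * alpha).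
Proof.
elim: i => [|i IH]; first by rewrite /= mul1r.
by rewrite iterS IH /rotation frac_partD [in RHS]mulrSr mulrDl mul1r addrA.
Qed.
End Arc.

(** * Denominators of convergents *)

Section ContinuedFraction.
Variable R : realType.
Variable alpha : R.
Hypothesis alpha01 : 0 <= alpha < 1.
Hypothesis alpha_irr : irrational alpha.

Notation tail n := (iter n gauss_map alpha).
Notation digit n := (partial_quotient alpha n).

Lemma irrational_neq0 (x : R) : irrational x -> x != 0.
Proof.
by move=> ix; apply/eqP => x0; apply: ix; exists 0 => //; rewrite x0 rmorph0.
Qed.

Lemma irrational_gauss_map (x : R) : irrational x -> irrational (gauss_map x).
Proof.
move=> ix [u _ ux]; apply: ix; exists (u + (Num.floor x^-1)%:~R)^-1 => //.
by rewrite fmorphV rmorphD /= ratr_int ux /gauss_map /frac_part subrK invrK.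
Qed.

Lemma tail_irrational n : irrational (tail n).
Proof. by elim: n => [|n IH] //=; exact: irrational_gauss_map. Qed.

Lemma tail_itv n : 0 < tail n < 1.
Proof.
have : 0 <= tail n < 1 by case: n => [|n] //=; exact: frac_part_itv.
by rewrite le_eqVlt eq_sym (negbTE (irrational_neq0 (@tail_irrational n))).
Qed.

Lemma inv_tail n : (tail n)^-1 = (digit n)%:~R + tail n.+1.
Proof. by rewrite /= /gauss_map /frac_part /partial_quotient; ring. Qed.

Lemma digit_ge1 n : 1 <= digit n.
Proof.
rewrite /partial_quotient floor_ge_int.
by have /andP[t0 t1] := tail_itv n; rewrite invf_ge1 // ltW.
Qed.

(** The two-term recursion of the numerators and the denominators of the
    convergents carries the last two values; their values at index [-1] are [1]
    and [0], whence the starting pairs of [P] and [Q] below. *)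
Fixpoint continuant (u v : int) n : int * int :=
  if n is m.+1 then
    let xy := continuant u v m in (digit m * xy.1 + xy.2, xy.1)
  else (u, v).

Notation P := (continuant 0 1).
Notation Q := (continuant 1 0).

Lemma denominator_ge n : [/\ n%:Z <= (Q n).1, 1 <= (Q n).1, 0 <= (Q n).2,
  (Q n).2 <= (Q n).1 & (0 < n)%N -> 1 <= (Q n).2].
Proof.
elim: n => [|n [IH1 IH2 IH3 IH4 IH5]] //.
have d1 := digit_ge1 n.
have h : (Q n).1 <= digit n * (Q n).1 by rewrite ler_peMl //; lia.
by split; rewrite /=; case: n => [|n] in IH1 IH2 IH3 IH4 IH5 d1 h *; lia.
Qed.

Lemma continuant_det n :
  (Q n).1 * (P n).2 - (P n).1 * (Q n).2 = (-1) ^+ n.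
Proof.
elim: n => [|n IH]; first by rewrite /= mulr1 mul0r subr0 expr0.
by rewrite exprS mulN1r -IH /=; ring.
Qed.

(** Each error [q_n alpha - p_n] is minus the previous one times a tail of the
    continued fraction. *)
Lemma continuant_tail n :
  ((Q n).2%:~R * alpha - (P n).2%:~R) * tail n =
  - ((Q n).1%:~R * alpha - (P n).1%:~R).
Proof.
elim: n => [|n IH]; first by rewrite /=; ring.
have /andP[t0 _] := tail_itv n.
have -> : tail n.+1 = (tail n)^-1 - (digit n)%:~R by rewrite inv_tail addrC addKr.
pose e := (Q n).1%:~R * alpha - (P n).1%:~R.
pose e' := (Q n).2%:~R * alpha - (P n).2%:~R.
have eV : e * (tail n)^-1 = - e'.
  by rewrite (_ : e = - (e' * tail n)) 1?mulNr ?mulfK ?gt_eqF // /e /e' IH opprK.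
have -> : (Q n.+1).1%:~R * alpha - (P n.+1).1%:~R = (digit n)%:~R * e + e'.
  by rewrite /= !intrD !intrM /e /e'; ring.
rewrite -[(Q n.+1).2%:~R * _ - _]/e mulrBr eV; ring.
Qed.

(** Eliminating the previous error from the determinant identity by means of
    [continuant_tail] leaves [|q_n alpha - p_n| (q_n / t + q_(n-1)) = 1] with [t < 1]
    the [n]-th tail. *)
Lemma convergent_error n :
  `|(Q n).1%:~R * alpha - (P n).1%:~R| <= ((Q n).1%:~R)^-1.
Proof.
have [_ q1 q2 _ _] := denominator_ge n.
have /andP[t0 t1] := tail_itv n.
set e := _ - _; set e' := (Q n).2%:~R * alpha - (P n).2%:~R.
have he : e = - (e' * tail n) by rewrite continuant_tail opprK.
have hd : (Q n).1%:~R * e' - (Q n).2%:~R * e = - (-1) ^+ n.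
  rewrite -[in RHS]intr_sign -continuant_det intrB !intrM /e /e'; ring.
have qR : 1 <= (Q n).1%:~R :> R by rewrite ler1z.
have q2R : 0 <= (Q n).2%:~R :> R by rewrite ler0z.
have : `|(Q n).1%:~R * e' - (Q n).2%:~R * e| = 1 by rewrite hd normrN normr_sign.
rewrite he normrN normrM (gtr0_norm t0).
have -> : (Q n).1%:~R * e' - (Q n).2%:~R * - (e' * tail n) =
  e' * ((Q n).1%:~R + (Q n).2%:~R * tail n) by ring.
have h : 0 <= (Q n).2%:~R * tail n by rewrite mulr_ge0 // ltW.
rewrite normrM [X in _ * X]ger0_norm; last lra.
move=> h1; rewrite -(mul1r (_)^-1) ler_pdivlMr; last lra.
rewrite -[leRHS]h1 -mulrA ler_wpM2l //.
apply: (@le_trans _ _ (1 * (Q n).1%:~R)); last lra.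
by rewrite ler_wpM2r //; lra.
Qed.

Lemma convergent_coprime n : coprimez (Q n).1 (P n).1.
Proof.
apply/coprimezP; exists ((-1) ^+ n * (P n).2, - (-1) ^+ n * (Q n).2) => /=.
have -> : (-1) ^+ n * (P n).2 * (Q n).1 + - (-1) ^+ n * (Q n).2 * (P n).1 =
  (-1) ^+ n * ((Q n).1 * (P n).2 - (P n).1 * (Q n).2) by ring.
by rewrite continuant_det -expr2 sqrr_sign.
Qed.

Lemma bounded_digits :
  (limn_esup (fun n => ((digit n)%:~R : R)%:E) < +oo)%E ->
  exists A : int, forall n, digit n <= A.
Proof.
rewrite limn_esup_lim (cvg_lim _ (@cvg_esups_inf _ _)) //.
move=> /ereal_inf_lt[_ [N _ <-]] supN.
pose u n := ((digit n)%:~R : R)%:E.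
have tailN n : (N <= n)%N -> (digit n)%:~R <= fine (esups u N).
  move=> Nn; have le : (u n <= esups u N)%E.
    by apply: ereal_sup_ubound; exists n.
  by rewrite -lee_fin fineK // fin_numElt supN (lt_le_trans (ltNyr _) le).
set B := fine _ in tailN.
exists (`|Num.floor B| + \sum_(i < N) digit i) => n.
have dp i : 0 <= digit i by have := digit_ge1 i; lia.
have [Nn|nN] := leqP N n.
  apply: (@le_trans _ _ (Num.floor B)).
    by rewrite floor_ge_int tailN.
  by rewrite ler_wpDr ?sumr_ge0 // ler_norm.
rewrite ler_wpDl //.
by rewrite (bigD1 (Ordinal nN)) //= ler_wpDr // sumr_ge0.
Qed.
End ContinuedFraction.

(** Consecutive denominators of convergents have bounded ratio, because
    [q_(n+1) <= (a_n + 1) q_n]; so the first one above [X] is not much larger. *)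
Lemma badly_approximable_denominators (R : realType) (alpha : R) :
  0 <= alpha < 1 -> badly_approximable alpha ->
  exists2 C : R, 1 <= C & forall X : R, 1 <= X -> exists (q : nat) (p : int),
    [/\ X <= q%:R, q%:R <= C * X, coprimez q p &
        `|q%:R * alpha - p%:~R| <= q%:R^-1].
Proof.
move=> a01 [ia /(bounded_digits a01 ia)[A hA]].
have A0 : 0 <= A%:~R :> R.
  rewrite ler0z.
  exact: le_trans (le_trans ler01 (digit_ge1 a01 ia 0%N)) (hA 0%N).
exists (A%:~R + 1) => [|X X1]; first by rewrite lerDr.
pose Q := continuant alpha 1 0.
have exX : exists n, X <= (Q n).1%:~R.
  exists (Num.bound X); have [h _ _ _ _] := denominator_ge a01 ia (Num.bound X).
  apply: (@le_trans _ _ ((Num.bound X)%:~R)); last by rewrite ler_int.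
  by have := archi_boundP (le_trans ler01 X1) => /ltW.
case: (ex_minnP exX) => n Xn minn.
have [_ q1 q2 _ _] := denominator_ge a01 ia n.
rewrite -/Q in q1 q2.
have := convergent_error a01 ia n; have := convergent_coprime alpha n.
have qE : (Q n).1 = `|(Q n).1|%N :> int by rewrite gez0_abs //; lia.
rewrite -/Q => cop err.
exists `|(Q n).1|%N, (continuant alpha 0 1 n).1.
have qR : `|(Q n).1|%N%:R = (Q n).1%:~R :> R by rewrite [in RHS]qE -pmulrn.
rewrite qR -qE; split => //.
case: n => [|n] in Xn minn {q1 q2 err cop qE qR} *.
  rewrite /=; apply: (le_trans X1); rewrite mulrDl mul1r lerDr.
  by rewrite mulr_ge0 //; lra.
have Xlt : (Q n).1%:~R < X.
  by rewrite ltNge; apply/negP => /minn; rewrite ltnn.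
apply: (@le_trans _ _ ((A + 1) %:~R * (Q n).1%:~R)).
  rewrite -intrM ler_int.
  have [_ q1 q2 q21 _] := denominator_ge a01 ia n.
  have dA := hA n.
  have -> : (Q n.+1).1 = partial_quotient alpha n * (Q n).1 + (Q n).2 by [].
  rewrite -/Q in q1 q2 q21; nia.
rewrite intrD ler_wpM2l //; last exact: ltW.
by rewrite addr_ge0.
Qed.

(** * Visits of an orbit to an arc *)

Section Discrepancy.
Variable R : realType.
Implicit Types (a r beta : R).

Lemma periodic_step (f : R -> R) (t : R) : (forall x, f (x + t) = f x) ->
  forall x (k : int), f (x + k%:~R * t) = f x.
Proof.
move=> ft x; have nat_step n y : f (y + n%:R * t) = f y.
  elim: n y => [|n IH] y; first by rewrite mul0r addr0.
  by rewrite mulrSr mulrDl mul1r addrA ft IH.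
case=> n; first exact: nat_step.
rewrite NegzE mulrNz mulNr.
by have := nat_step n.+1 (x - n.+1%:R * t); rewrite subrK => ->.
Qed.

(** The sum over a period of a rational rotation is a function of period [p / q]
    and of period [1], hence of period [1 / q] by Bezout. *)
Lemma rational_rotation_sum (f : R -> R) (q : nat) (p : int) (x : R) (k : int) :
  (0 < q)%N -> coprimez q p -> periodic f ->
  \sum_(j < q) f (x + k%:~R / q%:R + j%:R * (p%:~R / q%:R)) =
  \sum_(j < q) f (x + j%:R * (p%:~R / q%:R)).
Proof.
move=> q0 /coprimezP[[v u] /= bez] pf.
have qn0 : q%:R != 0 :> R by rewrite pnatr_eq0 -lt0n.
pose G z := \sum_(j < q) f (z + j%:R * (p%:~R / q%:R)).
have Gp z : G (z + p%:~R / q%:R) = G z.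
  pose F j := f (z + j%:R * (p%:~R / q%:R)).
  have -> : G (z + p%:~R / q%:R) = \sum_(j < q) F j.+1.
    by apply: eq_bigr => j _; rewrite /F mulrS mulrDl mul1r addrA.
  apply: (@addrI _ (F 0%N)).
  have -> : F 0%N + \sum_(j < q) F j.+1 = \sum_(j < q.+1) F j by rewrite big_ord_recl.
  rewrite big_ord_recr addrC; congr (_ + _).
  by rewrite /F /= mulrCA divff // mulr1 pf mul0r addr0.
have G1 z : G (z + 1) = G z.
  by apply: eq_bigr => j _; rewrite addrAC (pf _ 1).
transitivity (G (x + k%:~R / q%:R)) => //.
have -> : k%:~R / q%:R = (u * k)%:~R * (p%:~R / q%:R) + (v * k)%:~R * 1 :> R.
  have bezR : v%:~R * q%:R + u%:~R * p%:~R = 1 :> R.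
    by rewrite -[q%:R]/(q%:~R) -!intrM -intrD bez.
  rewrite !intrM -[LHS]mul1r -[X in X * (_ / _) = _]bezR; field.
  exact: qn0.
by rewrite addrA (periodic_step G1) (periodic_step Gp).
Qed.

(** The orbit segment is [1 / q]-close to that of the rotation by [p / q], for which
    the number of visits changes little, up to enlarging the arc by another
    [1 / q], when the starting point varies; so it is at most its mean over the
    starting point. *)
Lemma block_count beta a r (q : nat) (p : int) (y : R) :
  (0 < q)%N -> coprimez q p -> `|q%:R * beta - p%:~R| <= q%:R^-1 -> 0 <= r ->
  \sum_(j < q) chi a r (y + j%:R * beta) <= 2 * r * q%:R + 4.
Proof.
move=> q0 cop err r0.
have qR : 0 < q%:R :> R by rewrite ltr0n.
have qV : 0 < q%:R^-1 :> R by rewrite invr_gt0.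
pose G s z := \sum_(j < q) chi a s (z + j%:R * (p%:~R / q%:R)).
have to_rational : \sum_(j < q) chi a r (y + j%:R * beta) <= G (r + q%:R^-1) y.
  apply: ler_sum => j _; apply: le_chi.
  rewrite (_ : _ - _ = - (j%:R / q%:R) * (q%:R * beta - p%:~R)); last first.
    by field; rewrite gt_eqF.
  rewrite normrM normrN (@ger0_norm _ (j%:R / q%:R)) ?divr_ge0 //.
  apply: (@le_trans _ _ (j%:R / q%:R * q%:R^-1)).
    by rewrite ler_wpM2l ?divr_ge0.
  by rewrite ler_piMl ?(ltW qV) // ler_pdivrMr // mul1r ler_nat ltnW.
have spread z : G (r + q%:R^-1) y <= G (r + q%:R^-1 + q%:R^-1) z.
  pose k := Num.floor ((z - y) * q%:R).
  rewrite /G -(rational_rotation_sum y k q0 cop (@chi_periodic _ _ _)).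
  apply: ler_sum => j _; apply: le_chi.
  rewrite (_ : _ - _ = ((z - y) * q%:R - k%:~R) / q%:R).
    2: by field; rewrite gt_eqF.
  rewrite normrM (gtr0_norm qV) ler_piMl ?(ltW qV) //.
  by have := floor_itv ((z - y) * q%:R); rewrite intrD -/k ler_norml; lra.
apply: (le_trans to_rational); rewrite -(mean_cst (G (r + q%:R^-1) y)).
have bchi s j : bounded_measurable (fun z => chi a s (z + j%:R * (p%:~R / q%:R))).
  by apply: bounded_measurable_shift; exact: bounded_measurable_chi.
apply: (@le_trans _ _ (mean (G (r + q%:R^-1 + q%:R^-1)))).
  apply: le_mean => //; first exact: bounded_measurable_cst.
  exact: bounded_measurable_sum.
rewrite /G mean_sum //.
rewrite (eq_bigr (fun=> mean (chi a (r + q%:R^-1 + q%:R^-1)))); last first.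
  move=> j _; apply: mean_shift; last exact: chi_periodic.
  exact: bounded_measurable_chi.
rewrite sumr_const card_ord mean_chi; last lra.
apply: (@le_trans _ _ ((2 * (r + q%:R^-1 + q%:R^-1)) *+ q)).
  by rewrite lerMn2r ge_min lexx orbT.
have -> // : (2 * (r + q%:R^-1 + q%:R^-1)) *+ q = 2 * r * q%:R + 4.
by rewrite -mulr_natr; field; rewrite gt_eqF.
Qed.
(** The parameter [s] trades the relative error [1 / s] against the additive error
    [K s]: the orbit is cut into blocks whose length [q] is about [4 s / m], so that
    the error [4] of each block is at most [q m / s], and only the last,
    incomplete, block costs [O (s)]. *)
Lemma orbit_count_le (alpha : R) : 0 <= alpha < 1 -> badly_approximable alpha ->
  exists2 K : R, 0 <= K & forall a r s y (n : nat), 0 <= r -> 1 <= s ->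
    \sum_(k < n) chi a r (y - k%:R * alpha) <=
    n%:R * arc_measure r + (n%:R * arc_measure r / s + K * s).
Proof.
move=> a01 bad; have [C C1 denom] := badly_approximable_denominators a01 bad.
exists (4 * C + 4) => [|a r s y n r0 s1]; first lra.
have s0 : 0 < s by lra.
have Ks : 0 <= (4 * C + 4) * s by rewrite mulr_ge0 //; lra.
have [r12|r12] := leP (2 * r) 1; last first.
  rewrite /arc_measure min_r ?(ltW r12) // mulr1.
  apply: (@le_trans _ _ n%:R).
    rewrite -[X in _ <= X%:R]card_ord -sum1_card natr_sum.
    by apply: ler_sum => k _; exact: chi_le1.
  by rewrite lerDl addr_ge0 // divr_ge0 // ltW.
rewrite /arc_measure min_l //; set m := 2 * r in r12 *.
have m_ge0 : 0 <= m by rewrite mulr_ge0.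
have [r00|rn0] := eqVneq r 0.
  rewrite big1; last by move=> k _; rewrite chi_radius0 // r00.
  by rewrite addr_ge0 ?mulr_ge0 // addr_ge0 // divr_ge0 ?mulr_ge0 // ltW.
have m0 : 0 < m by rewrite /m mulr_gt0 // lt_neqAle eq_sym rn0.
have X1 : 1 <= 4 * s / m by rewrite ler_pdivlMr // mul1r; lra.
have [q [p [Xq qX cop err]]] := denom _ X1.
have q0 : (0 < q)%N by rewrite -(ltr_nat R); lra.
have qR : 0 < q%:R :> R by rewrite ltr0n.
(* the orbit runs backwards, that is, along the rotation by - alpha *)
have block z : \sum_(k < q) chi a r (z - k%:R * alpha) <= m * q%:R + 4.
  have := @block_count (- alpha) a r q (- p) z q0; rewrite coprimezN => /(_ cop).
  rewrite mulrN mulrNz opprK addrC -normrN opprD opprK [X in `|X|]addrC.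
  move=> /(_ err r0).
  by under eq_bigr do rewrite mulrN.
have blocks t z :
    \sum_(k < t * q) chi a r (z - k%:R * alpha) <= t%:R * (m * q%:R + 4).
  elim: t z => [|t IH] z; first by rewrite mul0n big_ord0 mul0r.
  rewrite mulSn big_split_ord /= [t.+1%:R]mulrS mulrDl mul1r.
  apply: lerD; first exact: block.
  apply: le_trans (IH (z - q%:R * alpha)).
  by apply: ler_sum => k _; rewrite natrD mulrDl opprD addrA.
have nq : (n <= (n %/ q).+1 * q)%N by rewrite ltnW // ltn_ceil.
apply: (@le_trans _ _ (\sum_(k < (n %/ q).+1 * q) chi a r (y - k%:R * alpha))).
  rewrite -(subnKC nq) big_split_ord /= lerDl.
  by apply: sumr_ge0 => k _; exact: chi_ge0.
apply: le_trans (blocks _ _) _.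
rewrite mulrS mulrDl mul1r.
have h1 : (n %/ q)%:R * q%:R <= n%:R :> R by rewrite -natrM ler_nat leq_trunc_div.
have h2 : 4 * s <= q%:R * m by rewrite -ler_pdivrMr.
have h3 : q%:R * m <= C * (4 * s).
  have -> : C * (4 * s) = C * (4 * s / m) * m by rewrite -mulrA divfK // gt_eqF.
  by rewrite ler_wpM2r // ltW.
have h4 : (n %/ q)%:R * 4 <= n%:R * m / s.
  rewrite ler_pdivlMr // -mulrA; apply: le_trans (ler_wpM2l _ h2) _ => //.
  by rewrite mulrA ler_wpM2r // ltW.
have h5 : (n %/ q)%:R * (m * q%:R) <= n%:R * m.
  by rewrite [m * _]mulrC mulrA ler_wpM2r // ltW.
rewrite mulrDr; lra.
Qed.
End Discrepancy.

(** * The variance of the number of hits *)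

Lemma symmetric_double_sum_le (R : realType) (N : nat) (g : 'I_N -> 'I_N -> R) :
  (forall i j, g i j = g j i) -> (forall i, 0 <= g i i) ->
  \sum_i \sum_j g i j <= 2 * \sum_(i < N) \sum_(j < N | (i <= j)%N) g i j.
Proof.
move=> gC g0.
have split_row (i : 'I_N) : \sum_(j < N) g i j =
    \sum_(j < N | (i <= j)%N) g i j + \sum_(j < N | (j < i)%N) g i j.
  rewrite (bigID (fun j : 'I_N => (i <= j)%N)) /=; congr (_ + _).
  by apply: eq_bigl => j; rewrite -ltnNge.
under eq_bigr do rewrite split_row.
rewrite big_split /= mulr2n mulrDl mul1r lerD2l.
rewrite (exchange_big_dep xpredT) //=; apply: ler_sum => i _.
rewrite [leRHS](bigD1 i) //= (eq_bigr (fun j => g i j)) => [|j _]; last first.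
  exact: gC.
rewrite [X in _ + X](eq_bigl (fun j : 'I_N => (i < j)%N)) ?lerDr // => j.
by rewrite ltn_neqAle andbC eq_sym.
Qed.

Section Variance.
Variable R : realType.
Variables (alpha a : R) (rho : nat -> R).
Hypothesis rho_ge0 : forall i, 0 <= rho i.
Hypothesis rho_noninc : forall i j, (i <= j)%N -> rho j <= rho i.

Definition hit i (x : R) : R := chi a (rho i) (x + i%:R * alpha).
Definition hits N x : R := \sum_(i < N) hit i x.
Definition expected_hits N : R := \sum_(i < N) arc_measure (rho i).

Lemma bounded_measurable_hit i : bounded_measurable (hit i).
Proof. by apply: bounded_measurable_shift; exact: bounded_measurable_chi. Qed.

Lemma mean_hit i : mean (hit i) = arc_measure (rho i).
Proof.
rewrite (mean_shift _ (bounded_measurable_chi a (rho i)) (@chi_periodic _ _ _)).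
exact: mean_chi.
Qed.

Lemma arc_measure_ge0 i : 0 <= arc_measure (rho i).
Proof. by rewrite le_min ler01 mulr_ge0. Qed.

(** The arcs are nested. *)
Lemma hits_initial_segment N y : exists2 t, (t <= N)%N &
  forall j, (j < N)%N -> chi a (rho j) y = (j < t)%:R.
Proof.
elim: N => [|N [t tN ht]]; first by exists 0%N.
have [yN|yN] := pselect (arc a (rho N) y); [exists N.+1|exists t] => // [j jN||j].
- rewrite jN chi_arc //; apply: arc_subset yN; exact: rho_noninc.
- exact: leq_trans (leqnSn _).
- rewrite ltnS leq_eqVlt => /predU1P[->|/ht //].
  by rewrite chi_not_arc // ltnNge tN.
Qed.

Definition centred i x := hit i x - arc_measure (rho i).

Lemma bounded_measurable_centred i : bounded_measurable (centred i).
Proof.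
apply: bounded_measurableB; first exact: bounded_measurable_hit.
exact: bounded_measurable_cst.
Qed.

Lemma mean_centred i : mean (centred i) = 0.
Proof.
rewrite meanB ?mean_hit ?mean_cst ?subrr //; last exact: bounded_measurable_cst.
exact: bounded_measurable_hit.
Qed.

(** The substitution [y = x + j alpha] turns the [j]-th hit into [y] lying in the
    [j]-th arc, which does not depend on the rotation. *)
Lemma covariance_seen_from_target i j : (i <= j)%N ->
  mean (fun x => centred i x * centred j x) =
  mean (fun y => chi a (rho j) y *
     (chi a (rho i) (y - (j - i)%:R * alpha) - arc_measure (rho i))).
Proof.
move=> ij.
have bchi := @bounded_measurable_chi R a.
have bi : bounded_measurable (fun y =>
    chi a (rho i) (y - (j - i)%:R * alpha) - arc_measure (rho i)).
  apply: bounded_measurableB; first exact: bounded_measurable_shift.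
  exact: bounded_measurable_cst.
rewrite -[RHS](mean_shift (j%:R * alpha)); first last.
- move=> y k; rewrite chi_periodic; congr (_ * (_ - _)).
  by rewrite addrAC chi_periodic.
- exact: bounded_measurableM.
transitivity (mean (fun x =>
    hit j x * centred i x - arc_measure (rho j) * centred i x)).
  by congr mean; apply/funext => x; rewrite mulrC mulrBl.
have bc := bounded_measurable_centred i; have bh := bounded_measurable_hit j.
rewrite meanB; [|exact: bounded_measurableM|].
  rewrite meanZ // mean_centred mulr0 subr0; congr mean; apply/funext => x.
  congr (_ * (_ - _)); rewrite /hit; congr (chi _ _ _).
  by rewrite -addrA -mulrBl natrB // opprB addrCA subrr addr0.
by apply: bounded_measurableM => //; exact: bounded_measurable_cst.
Qed.

Variables (K s : R).
Hypothesis s_ge1 : 1 <= s.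
Hypothesis count : forall (r y : R) (n : nat), 0 <= r ->
  \sum_(k < n) chi a r (y - k%:R * alpha) <=
  n%:R * arc_measure r + (n%:R * arc_measure r / s + K * s).

(** At a point [y] of the [i]-th arc, the [j >= i] that count form an interval
    starting at [i], and the sum is the excess of visits of one backward orbit
    segment of [y] to the [i]-th arc. *)
Lemma later_excess_le N (i : 'I_N) y :
  \sum_(j < N | (i <= j)%N) chi a (rho j) y *
     (chi a (rho i) (y - (j - i)%:R * alpha) - arc_measure (rho i)) <=
  chi a (rho i) y *
     ((\sum_(j < N) chi a (rho j) y) * arc_measure (rho i) / s + K * s).
Proof.
have [t tN ht] := hits_initial_segment N y.
have -> : \sum_(j < N) chi a (rho j) y = t%:R.
  transitivity (\sum_(j < N | (j < t)%N) (1 : R)).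
    rewrite [RHS]big_mkcond; apply: eq_bigr => j _.
    by rewrite ht //; case: (_ < _)%N.
  by rewrite -(big_ord_widen _ (fun=> 1)) // sumr_const card_ord.
pose G j := chi a (rho i) (y - (j - i)%:R * alpha) - arc_measure (rho i).
have -> : \sum_(j < N | (i <= j)%N) chi a (rho j) y * G j =
    \sum_(i <= j < t) G j.
  rewrite (big_nat_widen _ _ _ _ _ tN) /= big_geq_mkord.
  rewrite [RHS]big_mkcond [LHS]big_mkcond.
  apply: eq_bigr => j _; rewrite ht // andbC.
  by case: (i <= j)%N => //=; case: (j < t)%N; rewrite ?mul1r ?mul0r.
have [ti|it] := leqP t i.
  by rewrite big_geq // ht // ltnNge ti mul0r.
rewrite ht // it mul1r -{1}[nat_of_ord i]add0n big_addn big_mkord.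
rewrite (eq_bigr (fun k : 'I_(t - i) =>
    chi a (rho i) (y - k%:R * alpha) - arc_measure (rho i))).
  rewrite sumrB sumr_const card_ord lerBlDl -(mulr_natl (arc_measure _)).
  apply: (le_trans (count y (t - i)%N (rho_ge0 i))); rewrite lerD2l lerD2r.
  rewrite ler_pM2r ?invr_gt0; last exact: lt_le_trans s_ge1.
  by rewrite ler_wpM2r ?arc_measure_ge0 // ler_nat leq_subr.
by move=> k _; rewrite /G addnK.
Qed.

(** The variance is at most twice the sum of the covariances with [i <= j].
    Summed over [i], the bound of [later_excess_le] at [y] is
    [n (E_N / s + K s)], where [n] is the number of arcs containing [y], and the
    mean of [n] over [y] is [E_N]. *)
Lemma variance_le N :
  mean (fun x => (hits N x - expected_hits N) ^+ 2) <=
  2 * ((expected_hits N / s + K * s) * expected_hits N).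
Proof.
pose g (i j : 'I_N) := mean (fun x => centred i x * centred j x).
have bc i := bounded_measurable_centred i.
have bcc i j : bounded_measurable (fun x => centred i x * centred j x).
  exact: bounded_measurableM.
have bchi := @bounded_measurable_chi R a.
have -> : mean (fun x => (hits N x - expected_hits N) ^+ 2) =
    \sum_i \sum_j g i j.
  transitivity (mean (fun x =>
      \sum_(i < N) \sum_(j < N) centred i x * centred j x)).
    congr mean; apply/funext => x.
    by rewrite expr2 /hits /expected_hits -sumrB big_distrlr.
  rewrite mean_sum => [|i]; last exact: bounded_measurable_sum.
  by apply: eq_bigr => i _; rewrite mean_sum.
apply: (@le_trans _ _ (2 * \sum_(i < N) \sum_(j < N | (i <= j)%N) g i j)).
  apply: symmetric_double_sum_le => [i j|i].
    by congr mean; apply/funext => x; rewrite mulrC.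
  rewrite -(mean_cst (0 : R)); apply: le_mean => // [|x].
    exact: bounded_measurable_cst.
  by rewrite -expr2 sqr_ge0.
rewrite ler_wpM2l //.
pose F (i j : nat) y := chi a (rho j) y *
     (chi a (rho i) (y - (j - i)%:R * alpha) - arc_measure (rho i)).
have bF i j : bounded_measurable (F i j).
  apply: bounded_measurableM => //; apply: bounded_measurableB.
    exact: bounded_measurable_shift.
  exact: bounded_measurable_cst.
have -> : \sum_(i < N) \sum_(j < N | (i <= j)%N) g i j =
    mean (fun y => \sum_(i < N) \sum_(j < N | (i <= j)%N) F i j y).
  rewrite mean_sum => [|i]; last exact: bounded_measurable_sum.
  apply: eq_bigr => i _; rewrite mean_sum //; apply: eq_bigr => j ij.
  exact: covariance_seen_from_target.
have mean_count :
    mean (fun y => \sum_(i < N) chi a (rho i) y) = expected_hits N.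
  by rewrite mean_sum //; apply: eq_bigr => i _; exact: mean_chi.
rewrite -[X in _ * X]mean_count -meanZ; last exact: bounded_measurable_sum.
apply: le_mean => [||y].
- by apply: bounded_measurable_sum => i; exact: bounded_measurable_sum.
- apply: bounded_measurableM; first exact: bounded_measurable_cst.
  exact: bounded_measurable_sum.
apply: le_trans (ler_sum _ (fun i _ => later_excess_le i y)) _.
set n := \sum_(i < N) chi a (rho i) y.
have n0 : 0 <= n by apply: sumr_ge0 => i _; exact: chi_ge0.
rewrite mulrDl [_ * n in leRHS]mulrC mulrA.
apply: (@le_trans _ _ (\sum_(i < N)
    (n / s * arc_measure (rho i) + K * s * chi a (rho i) y))).
  apply: ler_sum => i _; rewrite mulrDr [K * s * _]mulrC lerD2r.
  rewrite [n * _ / s]mulrAC ler_piMl ?chi_le1 // !mulr_ge0 ?arc_measure_ge0 //.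
  by rewrite invr_ge0; apply: le_trans s_ge1.
rewrite big_split /= -!mulr_sumr -/n -/(expected_hits N) lerD2r.
by rewrite mulrAC.
Qed.
End Variance.

(** * Almost sure convergence along a sequence of times *)

Lemma ae_lebesgue_imply (R : realType) (P Q : R -> Prop) :
  (forall x, P x -> Q x) ->
  {ae @lebesgue_measure R, forall x : R, P x} ->
  {ae @lebesgue_measure R, forall x : R, Q x}.
Proof.
move=> PQ [A [mA A0 PA]]; exists A; split => //.
by apply: subset_trans PA => x /= nQ /PQ.
Qed.

(** The sum of the functions is integrable, hence finite almost everywhere. *)
Lemma ae_cvg0_summable_means (R : realType) (f : nat -> R -> R) (M : R) :
  (forall k, bounded_measurable (f k)) -> (forall k x, 0 <= f k x) ->
  (forall n, \sum_(k < n) mean (f k) <= M) ->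
  {ae @lebesgue_measure R, forall x : R, 0 <= x < 1 ->
    f k x @[k --> \oo] --> (0 : R)}.
Proof.
move=> bf f0 fM.
have mf k : measurable_fun (`[0, 1[%classic : set R) (EFin \o f k).
  apply/measurable_EFinP; exact: measurable_funS (bf k).1.
pose F (x : R) : \bar R := (\sum_(k <oo) (f k x)%:E)%E.
have F_ge0 x : (0 <= F x)%E by apply: nneseries_ge0 => k _ _; rewrite lee_fin.
have intF : (@lebesgue_measure R).-integrable `[0, 1[ F.
  apply/integrableP; split.
    exact: (@ge0_emeasurable_sum _ _ _ _ (fun k x => (f k x)%:E) xpredT
      (fun k x _ _ => f0 k x) (fun k _ => mf k)).
  under eq_integral do rewrite gee0_abs //.
  rewrite /F integral_nneseries //; last by move=> k x _; rewrite lee_fin.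
  apply: (@le_lt_trans _ _ M%:E); last exact: ltry.
  apply: lime_le.
    apply: is_cvg_nneseries => k _ _.
    by apply: integral_ge0 => x _; rewrite lee_fin.
  apply: nearW => n; rewrite big_mkord.
  rewrite (eq_bigr (fun k : 'I_n => (mean (f k))%:E)).
    by rewrite sumEFin lee_fin; exact: fM.
  move=> k _; rewrite /mean /Rintegral fineK //.
  by apply: integrable_fin_num => //; exact: bounded_measurable_integrable1.
have mI : measurable (`[0, 1[%classic : set (measurableTypeR R)).
  exact: measurable_itv.
have := integrable_ae mI intF.
apply: filterS => x Fx x01.
have {Fx} : F x \is a fin_num by apply: Fx; rewrite /= in_itv.
rewrite ge0_fin_numE // => Fx.
apply: (@cvg_series_cvg_0 R R (f ^~ x)).
apply: nondecreasing_is_cvgn.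
  by apply/nondecreasing_seqP => n; rewrite /series /= big_nat_recr //= lerDl.
exists (fine (F x)) => _ [n _ <-].
rewrite /series /= -lee_fin fineK ?ge0_fin_numE // -sumEFin.
by apply: nneseries_lim_ge => k _ _; rewrite lee_fin.
Qed.

Section Interpolation.
Variable R : realType.
Variables (S E : nat -> R) (N_ : nat -> nat).
Hypothesis S_nd : forall m n, (m <= n)%N -> S m <= S n.
Hypothesis E_nd : forall m n, (m <= n)%N -> E m <= E n.
Hypothesis E_gt0 : forall k, 0 < E (N_ k).
Hypothesis N_nd : forall j k, (j <= k)%N -> (N_ j <= N_ k)%N.
Hypothesis N_cofinal : forall n, exists k, (n < N_ k)%N.
Hypothesis ratio : forall d, 0 < d ->
  \forall k \near \oo, E (N_ k.+1) <= (1 + d) * E (N_ k).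
Hypothesis subseq_cvg :
  ((S (N_ k) - E (N_ k)) / E (N_ k)) ^+ 2 @[k --> \oo] --> (0 : R).

(** Between two consecutive times [N_ k <= n < N_ k.+1] both [S n] and [E n] are
    squeezed between their values at these times, and these values of [E] are
    asymptotically equal. *)
Lemma cvg_ratio_interpolation : S n / E n @[n --> \oo] --> (1 : R).
Proof.
apply/cvgrPdist_le => e e0.
(* so that (1 + d) ^ 2 <= 1 + 3 d <= 1 + e *)
pose d := Num.min e 1 / 3.
have min_gt0 : 0 < Num.min e 1 by rewrite lt_min e0 ltr01.
have d0 : 0 < d by rewrite /d; lra.
have min1 : Num.min e 1 <= 1 by rewrite ge_min lexx orbT.
have mine : Num.min e 1 <= e by rewrite ge_min lexx.
have d1 : d <= 3^-1 by rewrite /d; lra.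
have de : 3 * d <= e by rewrite /d; lra.
have [k0 _ near_sub] : \forall k \near \oo,
    `|S (N_ k) - E (N_ k)| <= d * E (N_ k).
  move/cvgrPdist_le : subseq_cvg => /(_ (d ^+ 2) (exprn_gt0 _ d0)).
  apply: filterS => k; rewrite sub0r normrN ger0_norm ?sqr_ge0 //.
  rewrite -[_ ^+ 2]real_normK ?num_real // ler_pXn2r ?nnegrE // ?(ltW d0) //.
  by rewrite normrM normfV (gtr0_norm (E_gt0 k)) ler_pdivrMr.
have [k1 _ near_ratio] := ratio d0.
pose k2 := maxn k0 k1.
exists (N_ k2) => // n /= nk2.
have [k [k2k kn nk]] : exists k,
    [/\ (k2 <= k)%N, (N_ k <= n)%N & (n < N_ k.+1)%N].
  have exk : exists j, (n < N_ (k2 + j))%N.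
    have [k nk] := N_cofinal n; exists k.
    by apply: leq_trans nk _; rewrite N_nd ?leq_addl.
  case: (ex_minnP exk) => -[|j] nj minj.
    by move: nj; rewrite addn0 ltnNge nk2.
  exists (k2 + j)%N; rewrite leq_addr -addnS nj; split => //.
  by rewrite leqNgt; apply/negP => /minj; rewrite ltnn.
have k0k : (k0 <= k)%N by rewrite (leq_trans _ k2k) // leq_maxl.
have k1k : (k1 <= k)%N by rewrite (leq_trans _ k2k) // leq_maxr.
have /= rk := near_ratio _ k1k.
have := near_sub _ k0k; rewrite /= ler_norml => /andP[lk uk].
have := near_sub _ (leqW k0k); rewrite /= ler_norml => /andP[lk1 uk1].
have := S_nd kn; have := S_nd (ltnW nk).
have := E_nd kn; have := E_nd (ltnW nk); have := E_gt0 k.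
move: (S n) (E n) (S (N_ k)) (E (N_ k)) (S (N_ k.+1)) (E (N_ k.+1))
  rk lk uk lk1 uk1.
move=> s x s0 x0 s1 x1 rk lk uk lk1 uk1 x00 xx1 x0x ss1 s0s.
have xp : 0 < x by lra.
have -> : 1 - s / x = (x - s) / x by rewrite mulrBl divff // gt_eqF.
rewrite normrM normfV (gtr0_norm xp) ler_pdivrMr // ler_norml.
have dd : d * d <= d * 3^-1 by rewrite ler_wpM2l // ltW.
have hu : s <= (1 + 3 * d) * x.
  apply: (@le_trans _ _ ((1 + d) * x1)); first lra.
  apply: (@le_trans _ _ ((1 + d) * ((1 + d) * x))).
    rewrite ler_wpM2l //; first lra.
    apply: le_trans rk _; rewrite ler_wpM2l //; lra.
  rewrite mulrA ler_wpM2r //; [lra|nra].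
have hl : (1 - 2 * d) * x <= s.
  apply: (@le_trans _ _ ((1 - d) * x0)); last lra.
  apply: (@le_trans _ _ ((1 - 2 * d) * ((1 + d) * x0))).
    rewrite ler_wpM2l //; lra.
  rewrite mulrA ler_wpM2r //; [lra|nra].
have h3 : 3 * d * x <= e * x by rewrite ler_wpM2r // ltW.
have h4 : 0 <= d * x by rewrite mulr_ge0 // ltW.
apply/andP; split; lra.
Qed.
End Interpolation.

Lemma sum_inv_sqr_le (R : realType) (n : nat) :
  \sum_(k < n) (k.+1%:R ^+ 2)^-1 <= 2 :> R.
Proof.
suff : \sum_(k < n) (k.+1%:R ^+ 2)^-1 <= 2 - 2 * n.+1%:R^-1 :> R.
  by move/le_trans; apply; rewrite gerBl mulr_ge0 // invr_ge0.
(* each term is at most 2 / ((k + 1) (k + 2)), which telescopes *)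
elim: n => [|n IH]; first by rewrite big_ord0 invr1; lra.
rewrite big_ord_recr /=; apply: (le_trans (lerD IH (lexx _))).
have n1 : 1 <= n.+1%:R :> R by rewrite ler1n.
rewrite [n.+2%:R]mulrSr; move: (n.+1%:R) n1 => t t1.
have t0 : t != 0 by rewrite gt_eqF //; lra.
have t10 : t + 1 != 0 by rewrite gt_eqF //; lra.
rewrite -subr_ge0.
have -> : 2 - 2 * (t + 1)^-1 - (2 - 2 * t^-1 + (t ^+ 2)^-1) =
    (t - 1) / (t ^+ 2 * (t + 1)).
  by field; apply/andP.
by rewrite divr_ge0 ?mulr_ge0 ?sqr_ge0 //; lra.
Qed.

Section AlmostEverywhere.
Variable R : realType.
Variables (alpha a : R) (rho : nat -> R).
Hypothesis alpha01 : 0 <= alpha < 1.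
Hypothesis alpha_bad : badly_approximable alpha.
Hypothesis rho_ge0 : forall i, 0 <= rho i.
Hypothesis rho_noninc : forall i j, (i <= j)%N -> rho j <= rho i.
Hypothesis expected_unbounded : forall A, exists n, A <= expected_hits rho n.

Notation E := (expected_hits rho).
Notation S := (hits alpha a rho).

Lemma expected_hits_nd m n : (m <= n)%N -> E m <= E n.
Proof.
move/subnKC <-; rewrite /expected_hits big_split_ord /= lerDl.
by apply: sumr_ge0 => i _; exact: arc_measure_ge0.
Qed.

Lemma hits_nd x m n : (m <= n)%N -> S m x <= S n x.
Proof.
move/subnKC <-; rewrite /hits big_split_ord /= lerDl.
by apply: sumr_ge0 => i _; exact: chi_ge0.
Qed.

(** The exponent [4] makes [E (N_ k.+1) / E (N_ k)] tend to [1] while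
    [variance_le], with [s = (k + 1) ^ 2], bounds the variance of
    [S (N_ k) / E (N_ k)] by a multiple of [1 / (k + 1) ^ 2]. *)
Lemma quartic_times : exists N_ : nat -> nat,
  [/\ forall j k, (j <= k)%N -> (N_ j <= N_ k)%N,
      forall n, exists k, (n < N_ k)%N &
      forall k, k.+1%:R ^+ 4 <= E (N_ k) <= k.+1%:R ^+ 4 + 1].
Proof.
have /choice[N_ hN] : forall k, exists n, k.+1%:R ^+ 4 <= E n /\
    forall m, k.+1%:R ^+ 4 <= E m -> (n <= m)%N.
  move=> k; case: (ex_minnP (expected_unbounded (k.+1%:R ^+ 4))) => n hn minn.
  by exists n.
exists N_; split => [j k jk|n|k].
- apply: (hN j).2; apply: le_trans (hN k).1.
  by rewrite lerXn2r ?nnegrE // ler_nat.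
- exists (Num.bound (E n)); rewrite ltnNge; apply/negP => /expected_hits_nd.
  apply/negP; rewrite -ltNge; apply: lt_le_trans (hN _).1.
  have E0 : 0 <= E n by apply: sumr_ge0 => i _; exact: arc_measure_ge0.
  apply: (lt_le_trans (archi_boundP E0)).
  apply: (@le_trans _ _ (Num.bound (E n)).+1%:R); first by rewrite ler_nat.
  by rewrite -{1}[_.+1%:R]expr1 ler_weXn2l // ler1n.
- have [-> /=] := hN k; case: (N_ k) => [|n] minn.
    by rewrite /expected_hits big_ord0 addr_ge0 // exprn_ge0.
  rewrite /expected_hits big_ord_recr /= lerD //.
    2: by rewrite ge_min lexx orbT.
  by apply: ltW; rewrite ltNge; apply/negP => /minn; rewrite ltnn.
Qed.

Lemma quartic_growth (d : R) : 0 < d ->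
  \forall k \near \oo, (k.+2%:R ^+ 4 + 1 : R) <= (1 + d) * k.+1%:R ^+ 4.
Proof.
(* 16 = 4 + 6 + 4 + 2 adds up the lower coefficients of (t + 1) ^ 4 + 1 *)
move=> d0; exists (Num.bound (16 / d)) => // k /= kb.
have d16 : 0 <= 16 / d by rewrite divr_ge0 // ltW.
have : 16 / d < k.+1%:R.
  by apply: (lt_le_trans (archi_boundP d16)); rewrite ler_nat leqW.
rewrite ltr_pdivrMr // [k.+2%:R]mulrSr => h.
have : 1 <= k.+1%:R :> R by rewrite ler1n.
move: (k.+1%:R) h => t h t1.
have t3 : 1 <= t ^+ 3 by rewrite exprn_ege1.
have h1 : 16 * t ^+ 3 <= d * t ^+ 4.
  have -> : d * t ^+ 4 = t * d * t ^+ 3 by ring.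
  by rewrite ler_wpM2r ?(ltW h) // exprn_ge0 //; lra.
have t2 : t ^+ 2 <= t ^+ 3 by rewrite ler_weXn2l.
have t1' : t <= t ^+ 3 by rewrite -{1}[t]expr1 ler_weXn2l.
have -> : (t + 1) ^+ 4 = t ^+ 4 + 4 * t ^+ 3 + 6 * t ^+ 2 + 4 * t + 1 by ring.
lra.
Qed.

Lemma ae_hits_ratio :
  {ae @lebesgue_measure R, forall x : R, 0 <= x < 1 ->
    S n x / E n @[n --> \oo] --> (1 : R)}.
Proof.
have [N_ [N_nd N_cof N_E]] := quartic_times.
have [K K0 count] := orbit_count_le alpha01 alpha_bad.
have pow_ge1 (k e : nat) : 1 <= k.+1%:R ^+ e :> R by rewrite exprn_ege1 // ler1n.
have E_gt0 k : 0 < E (N_ k).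
  have /andP[+ _] := N_E k; apply: lt_le_trans.
  by apply: lt_le_trans (pow_ge1 k 4%N).
pose f k x := ((S (N_ k) x - E (N_ k)) / E (N_ k)) ^+ 2.
pose V k x := (S (N_ k) x - E (N_ k)) ^+ 2.
have bV k : bounded_measurable (V k).
  have bS : bounded_measurable (fun x => S (N_ k) x - E (N_ k)).
    apply: bounded_measurableB; last exact: bounded_measurable_cst.
    by apply: bounded_measurable_sum => i; exact: bounded_measurable_hit.
  by rewrite /V; under eq_fun do rewrite expr2; exact: bounded_measurableM.
have fE k : f k = fun x => (E (N_ k) ^+ 2)^-1 * V k x.
  by apply/funext => x; rewrite /f /V exprMn exprVn mulrC.
have mean_f k : mean (f k) <= 2 * (1 + K) * (k.+1%:R ^+ 2)^-1.
  rewrite fE meanZ //.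
  have := variance_le rho_ge0 rho_noninc (pow_ge1 k 2%N)
    (fun r y n r0 => count a r _ y n r0 (pow_ge1 k 2%N)) (N_ k).
  rewrite -/(V k) => var.
  have Ek2 : (k.+1%:R ^+ 2) ^+ 2 <= E (N_ k).
    by rewrite -exprM; have /andP[] := N_E k.
  have s1 := pow_ge1 k 2%N.
  move: (k.+1%:R ^+ 2) (E (N_ k)) (E_gt0 k) Ek2 s1 var => s e e0 se s1 var.
  have s0 : 0 < s by lra.
  rewrite mulrC ler_pdivrMr ?exprn_gt0 //; apply: (le_trans var).
  have h : s <= e / s by rewrite ler_pdivlMr // -expr2.
  apply: (@le_trans _ _ (2 * ((e / s + K * (e / s)) * e))).
    by rewrite ler_wpM2l // ler_wpM2r ?(ltW e0) // lerD2l ler_wpM2l.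
  have -> // : 2 * ((e / s + K * (e / s)) * e) = 2 * (1 + K) / s * e ^+ 2.
  by field; rewrite gt_eqF.
have := @ae_cvg0_summable_means R f (2 * (1 + K) * 2).
have bf k : bounded_measurable (f k).
  by rewrite fE; apply: bounded_measurableM => //; exact: bounded_measurable_cst.
move=> /(_ bf (fun k x => sqr_ge0 _)) ae_f.
have {ae_f} : {ae @lebesgue_measure R, forall x : R, 0 <= x < 1 ->
    f k x @[k --> \oo] --> (0 : R)}.
  apply: ae_f => n; apply: (le_trans (ler_sum _ (fun (k : 'I_n) _ => mean_f k))).
  by rewrite -mulr_sumr ler_wpM2l ?sum_inv_sqr_le // mulr_ge0 // addr_ge0.
apply: ae_lebesgue_imply => x fx x01.
apply: (@cvg_ratio_interpolation R (fun n => S n x) E N_) => //.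
- by move=> m n; exact: hits_nd.
- by move=> m n; exact: expected_hits_nd.
- move=> d d0; have := quartic_growth d0; apply: filterS => k.
  have /andP[_ h1] := N_E k.+1; have /andP[h2 _] := N_E k => h.
  apply: (le_trans h1); apply: (le_trans h); rewrite ler_wpM2l //; lra.
- exact: fx.
Qed.
End AlmostEverywhere.

(** * Expected hits and the sum of the diameters *)

Section Radii.
Variables (R : realType) (r : nat -> R).
Hypothesis r_noninc : forall i j : nat, (1 <= i)%N -> (i <= j)%N -> r j <= r i.
Hypothesis r_div : (\sum_(1 <= i < N.+1) r i) @[N --> \oo] --> +oo.

Lemma radius_ge0 i : 0 <= r i.+1.
Proof.
rewrite leNgt; apply/negP => ri0.
move/cvgryPge : r_div => /(_ (\sum_(1 <= j < i.+2) r j + 1)).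
move=> [N0 _ /(_ (maxn N0 i.+1))]; rewrite /= leq_maxl => /(_ isT).
have iN : (i.+2 <= (maxn N0 i.+1).+1)%N by rewrite ltnS leq_maxr.
rewrite (big_cat_nat _ iN) //= lerD2l => h.
suff : \sum_(i.+2 <= j < (maxn N0 i.+1).+1) r j <= 0.
  by move=> /(le_trans h); lra.
rewrite big_nat_cond; apply: sumr_le0 => j /andP[/andP[ij _] _].
by apply: le_trans (ltW ri0); apply: r_noninc => //; exact: ltnW.
Qed.

Hypothesis r_half : limn r <= 2^-1.

Lemma radii_eventually_le (d : R) :
  0 < d -> \forall i \near \oo, r i.+1 <= 2^-1 + d.
Proof.
move=> d0.
have cr : cvgn (fun n => r n.+1).
  apply: nonincreasing_is_cvgn => [m n mn|]; first exact: r_noninc.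
  by exists 0 => _ [n _ <-]; exact: radius_ge0.
have lim_r : limn (fun n => r n.+1) = limn r.
  by apply/esym/cvg_lim => //; rewrite -cvg_shiftS.
have : limn (fun n => r n.+1) <= 2^-1 by rewrite lim_r.
move/cvgrPdist_le : cr => /(_ d d0); move: (limn _) => l near_l l_half.
apply: filterS near_l => n; rewrite ler_norml => /andP[h _]; lra.
Qed.

Notation rho := (fun i => r i.+1).

(** As soon as [r i <= 1], the measure [min (2 r i) 1] is at least [r i]. *)
Lemma expected_hits_unbounded (A : R) : exists n, A <= expected_hits rho n.
Proof.
have half_gt0 : 0 < 2^-1 :> R by rewrite invr_gt0.
have [n0 _ hn0] := radii_eventually_le half_gt0.
move/cvgryPge : r_div => /(_ (A + \sum_(i < n0) rho i))[N _ /(_ (n0 + N)%N)].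
rewrite /= leq_addl => /(_ isT) h; exists (n0 + N)%N.
move: h; rewrite big_add1 big_mkord /expected_hits !big_split_ord /=.
rewrite [A + _]addrC lerD2l; move/le_trans; apply; rewrite ler_wpDl //.
  by apply: sumr_ge0 => i _; exact: (@arc_measure_ge0 R rho radius_ge0 i).
apply: ler_sum => i _; have := hn0 (n0 + i)%N (leq_addr _ _).
have := radius_ge0 (n0 + i); rewrite /arc_measure le_min; lra.
Qed.

(** As soon as [r i <= 1 / 2 + e / 4], one has
    [2 r i <= (1 + e / 2) * min (2 r i) 1], on whichever side of [1 / 2] [r i] lies. *)
Lemma radii_sum_ratio :
  (\sum_(1 <= i < n.+1) 2 * r i) / expected_hits rho n @[n --> \oo] --> (1 : R).
Proof.
apply/cvgrPdist_le => e e0.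
have e4 : 0 < e / 4 by rewrite divr_gt0.
have [n0 _ hn0] := radii_eventually_le e4.
pose D n := \sum_(i < n) 2 * rho i.
have Enn n i : (n <= i)%N -> expected_hits rho n <= expected_hits rho i.
  by apply: expected_hits_nd => j; exact: radius_ge0.
have [n1 hn1] := expected_hits_unbounded (D n0 / (e / 2) + 1).
have D0 : 0 <= D n0 by apply: sumr_ge0 => i _; rewrite mulr_ge0 // radius_ge0.
exists (maxn n0 n1) => // n /=; rewrite geq_max => /andP[n0n n1n].
rewrite big_add1 big_mkord -/(D n).
have En : D n0 / (e / 2) + 1 <= expected_hits rho n.
  exact: le_trans hn1 (Enn _ _ n1n).
have De : 0 <= D n0 / (e / 2) by rewrite divr_ge0 //; lra.
have E0 : 0 < expected_hits rho n by lra.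
have ED : expected_hits rho n <= D n.
  by apply: ler_sum => i _; rewrite ge_min lexx.
have DE : D n <= D n0 + (1 + e / 2) * expected_hits rho n.
  rewrite -(subnKC n0n) {1}/D big_split_ord /= -/(D n0) lerD2l.
  rewrite /expected_hits big_split_ord /= mulrDr ler_wpDl //.
    rewrite mulr_ge0 ?sumr_ge0 //; first lra.
    by move=> i _; exact: (@arc_measure_ge0 R rho radius_ge0 i).
  rewrite mulr_sumr; apply: ler_sum => i _.
  have := hn0 (n0 + i)%N (leq_addr _ _); have := radius_ge0 (n0 + i).
  rewrite /arc_measure /Num.min; move: (r _) => x; case: ifP => [x1|x1] x0 xe.
    by rewrite ler_peMl ?mulr_ge0 //; lra.
  lra.
have -> : 1 - D n / expected_hits rho n =
    (expected_hits rho n - D n) / expected_hits rho n.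
  by rewrite mulrBl divff // gt_eqF.
rewrite normrM normfV (gtr0_norm E0) ler_pdivrMr //.
have : D n0 <= e / 2 * expected_hits rho n.
  rewrite mulrC -ler_pdivrMr; lra.
rewrite ler_norml mulrDl mul1r in DE *; lra.
Qed.
End Radii.

(* The radii are r 1, r 2, ...; the value r 0 plays no role.  The hypothesis on
   limn r is needed because the circle has length 1: a ball of radius r > 1/2
   has measure 1, not 2r (it holds trivially when r i tends to 0). *)
Theorem theorem1p2 (R : realType) (alpha : R) (r : nat -> R)
    (alpha01 : 0 <= alpha < 1)
    (alpha_bad : badly_approximable alpha)
    (r_noninc : forall i j : nat, (1 <= i)%N -> (i <= j)%N -> r j <= r i)
    (r_div : (\sum_(1 <= i < N.+1) r i) @[N --> \oo] --> +oo)
    (r_half : limn r <= 2^-1)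
    (a : R) (a01 : 0 <= a < 1) :
  {ae @lebesgue_measure R, forall x : R, 0 <= x < 1 ->
    ((\sum_(1 <= i < N.+1) \1_(circle_ball a (r i)) (iter i (rotation alpha) x))
       / (\sum_(1 <= i < N.+1) 2 * r i)) @[N --> \oo] --> (1 : R)}.
Proof.
pose rho i := r i.+1.
have rho_ge0 i : 0 <= rho i by exact: (radius_ge0 r_noninc r_div).
have rho_noninc i j : (i <= j)%N -> rho j <= rho i.
  by move=> ij; exact: r_noninc.
have unb := expected_hits_unbounded r_noninc r_div r_half.
(* the centre absorbs the shift between indices starting at 0 and at 1 *)
have := ae_hits_ratio (a - alpha) alpha01 alpha_bad rho_ge0 rho_noninc unb.
apply: ae_lebesgue_imply => x hx x01.
have hitsE n :
    \sum_(1 <= i < n.+1) \1_(circle_ball a (r i)) (iter i (rotation alpha) x)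
    = hits alpha (a - alpha) rho n x.
  rewrite big_add1 big_mkord; apply: eq_bigr => i _.
  rewrite iter_rotation circle_ball_chi // /hit chi_center.
  by rewrite mulrSr mulrDl mul1r addrA.
have ratio := radii_sum_ratio r_noninc r_div r_half.
have prod_cvg : hits alpha (a - alpha) rho n x / expected_hits rho n *
    ((\sum_(1 <= i < n.+1) 2 * r i) / expected_hits rho n)^-1
      @[n --> \oo] --> (1 : R).
  have one : (1 : R) = 1 * 1^-1 by rewrite invr1 mulr1.
  by rewrite {2}one; apply: cvgM (hx x01) _; apply: cvgV ratio; exact: oner_neq0.
apply: cvg_trans prod_cvg; apply: near_eq_cvg.
have [n1 hn1] := unb 1.
exists n1 => // n /= n1n; rewrite hitsE invf_div mulrA mulfVK //.
rewrite gt_eqF //.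
exact: lt_le_trans ltr01 (le_trans hn1 (expected_hits_nd rho_ge0 n1n)).
Qed.
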